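(* Let $m,n$ be nonzero integers such that $|m|$ and $|n|$ are not both equal to $1$, and let $BS(m,n)=\langle x,y\mid yx^my^{-1}=x^n\rangle$. If a group $G$ contains a subgroup isomorphic to $BS(m,n)$, or more generally contains the image of a homomorphism $\varphi:BS(m,n)\to G$ such that $\varphi(x)$ has infinite order and the image $\varphi(BS(m,n))$ is not virtually nilpotent, then $G$ does not have Helfgott type growth.
   Context: An infinite group $G$ has Helfgott type growth if there exist $c,\delta>0$ such that every nonempty finite subset $A$ of $G$ for which the generated subgroup $\langle A\rangle$ is not virtually nilpotent satisfies $|A^3|\ge c|A|^{1+\delta}$, where $A^3=\{a_1a_2a_3 : a_1,a_2,a_3\in A\}$. *)

(* Defs.v *)
From HB Require Import structures.
From mathcomp Require Import all_boot all_order all_algebra.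
From mathcomp Require Import finmap.
From mathcomp Require Import all_classical all_reals exp.

Set Implicit Arguments.
Unset Strict Implicit.
Unset Printing Implicit Defensive.

Local Open Scope classical_set_scope.
Local Open Scope group_scope.

Section Subgroups.
Variable G : groupType.
Implicit Types (A H K N : set G) (g : G).

Definition is_subgroup H : Prop :=
  [/\ H 1, (forall a b, H a -> H b -> H (a * b)) & (forall a, H a -> H a^-1)].

Definition gen_subgroup A : set G := smallest is_subgroup A.

Definition commutator_subgroup H K : set G :=
  gen_subgroup [set [~ h, k] | h in H & k in K].

Fixpoint lower_central H (i : nat) : set G :=
  if i is j.+1 then commutator_subgroup (lower_central H j) H else H.

Definition is_nilpotent H : Prop :=
  is_subgroup H /\ exists i, lower_central H i = [set 1].

Definition left_cosets K H : set (set G) :=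
  [set [set h * k | k in K] | h in H].

Definition virtually_nilpotent H : Prop :=
  exists N, [/\ is_nilpotent N, N `<=` H & finite_set (left_cosets N H)].

Definition infinite_order g : Prop :=
  forall k : nat, (0 < k)%N -> g ^+ k <> 1.

Definition triple_product (A : {fset G}) : {fset G} :=
  [fset p.1.1 * p.1.2 * p.2 | p in A `*` A `*` A]%fset.

End Subgroups.

(* The notion is meant for infinite G; infiniteness is not part of the predicate
   (a finite G satisfies it vacuously, its subgroups being virtually trivial). *)
Definition helfgott_type_growth (R : realType) (G : groupType) : Prop :=
  exists c delta : R, [/\ (0 < c)%R, (0 < delta)%R &
    forall A : {fset G}, A != fset0 ->
      ~ virtually_nilpotent (gen_subgroup [set` A]) ->
      (c * (#|` A|)%:R `^ (1 + delta) <= (#|` triple_product A|)%:R)%R].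

(* Groups given by generators and relations.  The letter (g, true) stands for
   the generator g and (g, false) for its formal inverse. *)
Definition word (X : Type) := seq (X * bool).

Definition word_inv (X : Type) (w : word X) : word X :=
  rev [seq (l.1, ~~ l.2) | l <- w].

Definition word_gen (X : Type) (g : X) : word X := [:: (g, true)].

Definition word_pow (X : Type) (g : X) (k : int) : word X :=
  nseq `|k|%N (g, (0 <= k)%R).

Inductive pres_eq (X : Type) (rels : word X -> word X -> Prop) :
    word X -> word X -> Prop :=
| pres_eq_refl u : pres_eq rels u u
| pres_eq_sym u v : pres_eq rels u v -> pres_eq rels v u
| pres_eq_trans u v w :
    pres_eq rels u v -> pres_eq rels v w -> pres_eq rels u w
| pres_eq_cat u u' v v' :
    pres_eq rels u u' -> pres_eq rels v v' ->
    pres_eq rels (u ++ v) (u' ++ v')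
| pres_eq_cancel g b : pres_eq rels [:: (g, b); (g, ~~ b)] [::]
| pres_eq_rel u v : rels u v -> pres_eq rels u v.

Section Presentation.
Variables (X : choiceType) (rels : word X -> word X -> Prop).

Definition pres_eqb : rel (word X) := fun u v => `[< pres_eq rels u v >].

Lemma pres_eqb_equiv : equiv_class_of pres_eqb.
Proof.
split=> [u|u v|v u w].
- by apply/asboolP; exact: pres_eq_refl.
- by apply/asboolP/asboolP => h; exact: pres_eq_sym.
- by move=> /asboolP h1 /asboolP h2; apply/asboolP; exact: pres_eq_trans h1 h2.
Qed.

Canonical pres_equiv : equiv_rel (word X) := EquivRelPack pres_eqb_equiv.

Definition presented : Type := {eq_quot pres_equiv}%qT.
HB.instance Definition _ := Choice.on presented.
HB.instance Definition _ := EqQuotient.on presented.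

Definition pres_class (w : word X) : presented := (\pi_presented w)%qT.
Definition pres_repr (a : presented) : word X := repr a.

Lemma pres_classP u v : pres_class u = pres_class v <-> pres_eq rels u v.
Proof.
split=> [/eqquotP/asboolP //|h].
by apply/eqquotP/asboolP.
Qed.

Lemma pres_reprK a : pres_class (pres_repr a) = a.
Proof. exact: reprK. Qed.

Lemma pres_repr_class w : pres_eq rels (pres_repr (pres_class w)) w.
Proof. by apply/pres_classP; rewrite pres_reprK. Qed.

Definition pres_one : presented := pres_class [::].
Definition pres_mul (a b : presented) : presented :=
  pres_class (pres_repr a ++ pres_repr b).
Definition pres_inv (a : presented) : presented :=
  pres_class (word_inv (pres_repr a)).

Lemma word_inv_cat u v : word_inv (u ++ v) = word_inv v ++ word_inv u :> word X.
Proof. by rewrite /word_inv map_cat rev_cat. Qed.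

Lemma word_invK : involutive (@word_inv X).
Proof.
move=> w; rewrite /word_inv map_rev revK -map_comp map_id_in// => -[g b] _ /=.
by rewrite negbK.
Qed.

Lemma pres_eq_catV w : pres_eq rels (w ++ word_inv w) [::].
Proof.
elim: w => [|[g b] w IH]; first exact: pres_eq_refl.
rewrite -[(g, b) :: w]/([:: (g, b)] ++ w) word_inv_cat catA -(catA _ w).
apply: pres_eq_trans (pres_eq_cancel rels g b).
rewrite -[[:: (g, b); _]]/(([:: (g, b)] ++ [::]) ++ [:: (g, ~~ b)]).
apply: pres_eq_cat; last exact: pres_eq_refl.
by apply: pres_eq_cat => //; exact: pres_eq_refl.
Qed.

Lemma pres_mulE u v : pres_mul (pres_class u) (pres_class v) = pres_class (u ++ v).
Proof. by apply/pres_classP; apply: pres_eq_cat; exact: pres_repr_class. Qed.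

Lemma pres_mulA : associative pres_mul.
Proof.
move=> a b c.
by rewrite -(pres_reprK a) -(pres_reprK b) -(pres_reprK c) !pres_mulE catA.
Qed.

Lemma pres_mul1 : left_id pres_one pres_mul.
Proof. by move=> a; rewrite -(pres_reprK a) pres_mulE. Qed.

Lemma pres_mulg1 : right_id pres_one pres_mul.
Proof. by move=> a; rewrite -(pres_reprK a) pres_mulE cats0. Qed.

Lemma pres_mulgV : right_inverse pres_one pres_inv pres_mul.
Proof.
move=> a; rewrite -{1}(pres_reprK a) pres_mulE.
by apply/pres_classP; exact: pres_eq_catV.
Qed.

Lemma pres_mulVg : left_inverse pres_one pres_inv pres_mul.
Proof.
move=> a; rewrite -{2}(pres_reprK a) pres_mulE; apply/pres_classP.
by rewrite -{2}(word_invK (pres_repr a)); exact: pres_eq_catV.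
Qed.

HB.instance Definition _ := isGroup.Build presented
  pres_mulA pres_mul1 pres_mulg1 pres_mulVg pres_mulgV.

End Presentation.

Inductive BS_gen := BS_x | BS_y.
HB.instance Definition _ := gen_eqMixin BS_gen.
HB.instance Definition _ := gen_choiceMixin BS_gen.

Definition BS_rel (m n : int) (u v : word BS_gen) : Prop :=
  u = word_gen BS_y ++ word_pow BS_x m ++ word_inv (word_gen BS_y) /\
  v = word_pow BS_x n.

Definition BS (m n : int) : groupType := presented (BS_rel m n).

Definition BSx (m n : int) : BS m n := pres_class _ (word_gen BS_x).

Definition isomorphic_subgroup (B G : groupType) (H : set G) : Prop :=
  is_subgroup H /\
  exists f : {multiplicative B -> G}, set_bij [set: B] H f.

(* Main.v *)
Require Import Defs.
From mathcomp Require Import all_boot all_order all_algebra.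
From mathcomp Require Import all_classical all_reals.
From HB Require Import structures.
From mathcomp Require Import finmap fraction exp zify ring lra.

Import Order.TTheory GRing.Theory Num.Theory.

(** Let a and b be the images of the generators x and y.  The defining relation
    rewrites as b a^|m| = c b with c = a^|n| or a^(-|n|), so a power of a standing
    to the right of b can be carried across b to the left, except for a
    remainder with exponent below |m|.  Take A_k to consist of b and the powers
    a^i with i < k.  In a product of three elements of A_k every long power of
    a can be gathered into one factor whose exponent ranges over an interval of
    length O(k), and the rest of the product takes boundedly many values: hence
    |A_k^3| = O(k) (card_triple_product).  When a has infinite order,
    |A_k| >= k, and A_k generates the whole image as soon as k > 1.  Linear
    growth is incompatible with |A^3| >= c |A|^(1+delta), so the image being
    not virtually nilpotent rules out Helfgott type growth
    (BS_image_no_growth).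

    A subgroup isomorphic to BS(m,n) is the image of an injective morphism, and
    it remains to see that x has infinite order in BS(m,n) and that BS(m,n) is
    not virtually nilpotent unless |m| = |n| = 1.  Both follow from letting
    BS(m,n) act on a field F by affine maps, x as u |-> u + 1 and y as
    u |-> lam u, which respects the relation as soon as lam m = n in F.

    For the order of x take F = Q and lam = n/m.  For the second claim, a
    virtually nilpotent group satisfies an Engel condition on powers: for any
    g, h some k > 0 makes an iterated commutator [..[g^k, h^k],.., h^k] trivial
    (virtually_nilpotent_engel).  If lam is not a root of unity, this fails for
    g = xy and h = y, since the translation part of the commutator gets
    multiplied by a nonzero scalar at each step.  A suitable lam exists: if
    |m| <> |n|, again n/m in Q; if |m| = |n| > 1, choose a prime p dividing m,
    and take the indeterminate t in F_p(t), where lam m = n reads 0 = 0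
    (BS_multiplier). *)

Set Implicit Arguments.
Unset Strict Implicit.
Unset Printing Implicit Defensive.

(** * Powers and commutators in virtually nilpotent groups *)

Section SubgroupPowers.
Local Open Scope group_scope.
Local Open Scope classical_set_scope.
Variable G : groupType.
Implicit Types (A H N : set G) (g h : G).

Lemma is_subgroupX H g k : is_subgroup H -> H g -> H (g ^+ k).
Proof.
move=> [H1 HM _] Hg; elim: k => [|k IH]; first by rewrite expg0.
by rewrite expgS; exact: HM.
Qed.

Lemma sub_gen_subgroup A : A `<=` gen_subgroup A.
Proof. exact: sub_smallest. Qed.

Lemma gen_subgroup_sub A H : is_subgroup H -> A `<=` H -> gen_subgroup A `<=` H.
Proof. exact: smallest_sub. Qed.

Lemma gen_subgroup_is_subgroup A : is_subgroup (gen_subgroup A).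
Proof.
split=> [K [[K1 _ _] _]//|a b aA bA K KA|a aA K KA]; case: (KA) => [[_ KM KV] _].
- by apply: KM; [exact: aA | exact: bA].
- by apply: KV; exact: aA.
Qed.

(** The cosets g^i N, for i in nat, are finitely many, so two of them coincide,
    and the quotient of the two powers lies in N. *)
Lemma finite_index_power N H g : is_subgroup N -> is_subgroup H ->
  finite_set (left_cosets N H) -> H g ->
  exists2 k, (0 < k)%N & N (g ^+ k).
Proof.
move=> [N1 NM NV] sH fin Hg.
pose coset i : set G := [set g ^+ i * k | k in N].
have [i [j [lt_ij eq_ij]]] : exists i j, (i < j)%N /\ coset i = coset j.
  apply: contrapT => nex; apply: infinite_nat.
  have inj : injective coset.
    move=> i j eq_ij; apply/eqP; rewrite eqn_leq; apply/andP; split.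
      by rewrite leqNgt; apply/negP => lt; apply: nex; exists j, i.
    by rewrite leqNgt; apply/negP => lt; apply: nex; exists i, j.
  apply: sub_finite_set (finite_preimage (in2W inj) fin) => i _ /=.
  by exists (g ^+ i) => //; exact: is_subgroupX.
exists (j - i)%N; first by rewrite subn_gt0.
have : coset j (g ^+ j) by exists 1 => //; rewrite mulg1.
rewrite -eq_ij => -[k Nk]; rewrite -{1}(subnKC (ltnW lt_ij)) expgnDr.
by move/mulgI <-.
Qed.

(** An obstruction to virtual nilpotency made of a single equation between two
    elements, so that it can be tested in any homomorphic image.  Suitable
    powers of g and h lie in the nilpotent subgroup N, where each commutator
    with h^k descends one step of the lower central series. *)
Lemma virtually_nilpotent_engel H g h : is_subgroup H ->
  virtually_nilpotent H -> H g -> H h ->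
  exists k i, (0 < k)%N /\ iter i (fun z => [~ z, h ^+ k]) (g ^+ k) = 1.
Proof.
move=> sH [N [[sN [i Ni]] NH fin]] Hg Hh.
have [k k0 Nk] := finite_index_power sN sH fin Hg.
have [l l0 Nl] := finite_index_power sN sH fin Hh.
(* A common multiple of the two exponents puts both powers in N at once. *)
exists (k * l)%N, i; split; first by rewrite muln_gt0 k0.
have Ng : N (g ^+ (k * l)) by rewrite expgnA; exact: is_subgroupX.
have Nh : N (h ^+ (k * l)) by rewrite mulnC expgnA; exact: is_subgroupX.
suff: lower_central N i (iter i (fun z => [~ z, h ^+ (k * l)]) (g ^+ (k * l))).
  by rewrite Ni.
elim: {Ni} i => //= i IH; apply: sub_gen_subgroup.
by exists (iter i (fun z => [~ z, h ^+ (k * l)]) (g ^+ (k * l))) => //;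
  exists (h ^+ (k * l)).
Qed.

End SubgroupPowers.

(** * Multiplicative maps between groups *)

Section GroupMorphism.
Local Open Scope group_scope.
Variables (B G : groupType) (phi : {multiplicative B -> G}).

Lemma multiplicative_gmulf1 : phi 1 = 1.
Proof. by apply: (mulgI (phi 1)); rewrite -gmulfM !mulg1. Qed.

(** Between groups multiplicativity forces preservation of 1; recording this
    gives access to the theory of unital morphisms. *)
Definition group_morphism : UMagmaMorphism.type B G :=
  HB.pack (phi : B -> G) phi
    (Multiplicative_isUMagmaMorphism.Build B G phi multiplicative_gmulf1).

Lemma multiplicative_gmulfX k : {morph phi : x / x ^+ k}.
Proof. exact: (gmulfXn group_morphism). Qed.

Lemma multiplicative_gmulfV : {morph phi : x / x^-1}.
Proof. exact: (gmulfV group_morphism). Qed.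

Lemma multiplicative_gmulfR : {morph phi : x y / [~ x, y]}.
Proof. exact: (gmulfR group_morphism). Qed.

End GroupMorphism.

Lemma gmulf_range_subgroup (B G : groupType) (phi : {multiplicative B -> G}) :
  is_subgroup (range phi).
Proof.
split=> [|_ _ [x _ <-] [y _ <-]|_ [x _ <-]].
- by exists 1%g => //; exact: (multiplicative_gmulf1 phi).
- by exists (x * y)%g => //; exact: (@gmulfM _ _ phi).
- by exists (x^-1)%g => //; exact: (multiplicative_gmulfV phi).
Qed.

(** * Morphisms out of a presented group *)

Section WordEvaluation.
Local Open Scope group_scope.
Variables (X : choiceType) (H : groupType) (v : X -> H).

Definition eval_letter (l : X * bool) : H := if l.2 then v l.1 else (v l.1)^-1.
Definition eval_word (w : word X) : H := \prod_(l <- w) eval_letter l.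

Lemma eval_word_cat u w : eval_word (u ++ w) = eval_word u * eval_word w.
Proof. by rewrite /eval_word big_cat. Qed.

Lemma eval_word_gen g : eval_word (word_gen g) = v g.
Proof. by rewrite /eval_word big_seq1. Qed.

Lemma eval_word_pow g k :
  eval_word (word_pow g k) = eval_letter (g, (0 <= k)%R) ^+ `|k|%N.
Proof.
rewrite /word_pow; elim: `|k|%N => [|j IH]; first by rewrite /eval_word big_nil.
by rewrite expgS -IH /eval_word /= big_cons.
Qed.

Lemma eval_word_invgen g : eval_word (word_inv (word_gen g)) = (v g)^-1.
Proof. by rewrite /eval_word big_seq1. Qed.

Lemma eval_pres_eq (rels : word X -> word X -> Prop) :
  (forall u w, rels u w -> eval_word u = eval_word w) ->
  forall u w, pres_eq rels u w -> eval_word u = eval_word w.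
Proof.
move=> hrel u w; elim=> {u w} //.
- by move=> u w s _ -> _ ->.
- by move=> u u' w w' _ hu _ hw; rewrite !eval_word_cat hu hw.
- move=> g b; rewrite /eval_word !big_cons big_nil mulg1 /eval_letter /=.
  by case: b; rewrite /= ?mulgV ?mulVg.
Qed.

(** The universal property of the presentation. *)
Lemma presented_lift (rels : word X -> word X -> Prop) :
  (forall u w, rels u w -> eval_word u = eval_word w) ->
  exists phi : {multiplicative presented rels -> H},
    forall w, phi (pres_class rels w) = eval_word w.
Proof.
move=> hrel; pose f (a : presented rels) := eval_word (pres_repr a).
have fE w : f (pres_class rels w) = eval_word w.
  by apply: (eval_pres_eq hrel); exact: pres_repr_class.
have fM : {morph f : a b / a * b}.
  by move=> a b; rewrite fE eval_word_cat.
pose fMul := isMultiplicative.Build _ _ f fM.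
pose phi : {multiplicative presented rels -> H} := HB.pack f fMul.
by exists phi.
Qed.

End WordEvaluation.

Lemma gmulf_pres_class (X : choiceType) (rels : word X -> word X -> Prop)
    (H : groupType) (phi : {multiplicative presented rels -> H}) w :
  phi (pres_class rels w) =
  eval_word (fun g => phi (pres_class rels (word_gen g))) w.
Proof.
elim: w => [|[g b] w IH].
  by rewrite /eval_word big_nil; exact: (multiplicative_gmulf1 phi).
rewrite /eval_word big_cons -/(eval_word _ w) -IH.
rewrite -[(g, b) :: w]/([:: (g, b)] ++ w) -pres_mulE.
rewrite [LHS](@gmulfM _ _ phi); congr (_ * _)%g.
case: b => //.
rewrite -[[:: (g, false)]]/(word_inv (word_gen g)) /eval_letter /=.
rewrite -(multiplicative_gmulfV phi); congr (phi _).
apply/esym/mulg1_eq; rewrite -[LHS]/(pres_mul _ _) pres_mulE.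
by apply/pres_classP; exact: pres_eq_catV.
Qed.

(** The generators generate. *)
Lemma range_presented_sub (X : choiceType) (rels : word X -> word X -> Prop)
    (H : groupType) (phi : {multiplicative presented rels -> H}) (K : set H) :
  is_subgroup K -> (forall g, K (phi (pres_class rels (word_gen g)))) ->
  (range phi `<=` K)%classic.
Proof.
move=> [K1 KM KV] Kg _ [a _ <-]; rewrite -(pres_reprK a) gmulf_pres_class.
elim: (pres_repr a) => [|[g b] w IH]; first by rewrite /eval_word big_nil.
rewrite /eval_word big_cons; apply: KM => //.
by case: b; [exact: Kg | apply: KV; exact: Kg].
Qed.

(** * Baumslag-Solitar groups *)

Section BaumslagSolitar.
Local Open Scope group_scope.
Variables (m n : int).

Definition BSy : BS m n := pres_class _ (word_gen BS_y).

Definition expgz (G : groupType) (g : G) (k : int) : G :=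
  if (0 <= k)%R then g ^+ `|k|%N else g ^- `|k|%N.

Lemma eval_word_expgz (H : groupType) (v : BS_gen -> H) g k :
  eval_word v (word_pow g k) = expgz (v g) k.
Proof.
rewrite eval_word_pow /expgz /eval_letter /=.
by case: ifP => // _; rewrite expVgn.
Qed.

Lemma BS_lift (H : groupType) (a b : H) :
  b * expgz a m * b^-1 = expgz a n ->
  exists2 phi : {multiplicative BS m n -> H},
    phi (BSx m n) = a & phi BSy = b.
Proof.
move=> hab; pose v g := if g is BS_x then a else b.
have hv u w : BS_rel m n u w -> eval_word v u = eval_word v w.
  case=> -> ->.
  rewrite !eval_word_cat !eval_word_expgz eval_word_gen eval_word_invgen /=.
  by rewrite mulgA.
have [phi phiE] := presented_lift hv.
by exists phi; rewrite [LHS]phiE eval_word_gen.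
Qed.

Lemma BS_morph_rel (G : groupType) (phi : {multiplicative BS m n -> G}) :
  phi BSy * expgz (phi (BSx m n)) m * (phi BSy)^-1 = expgz (phi (BSx m n)) n.
Proof.
have : BS_rel m n (word_gen BS_y ++ word_pow BS_x m ++ word_inv (word_gen BS_y))
    (word_pow BS_x n) by split.
move/(@pres_eq_rel _ (BS_rel m n))/pres_classP/(congr1 phi).
rewrite [in X in X -> _]gmulf_pres_class [X in _ = X -> _]gmulf_pres_class.
by rewrite !eval_word_cat !eval_word_expgz eval_word_gen eval_word_invgen mulgA.
Qed.

End BaumslagSolitar.

(** * The affine action of BS(m,n) on a field *)

Section AffineGroup.
Local Open Scope ring_scope.
Variables (F : fieldType) (lam : F) (lam_neq0 : lam != 0).

(** The pair (k, u) acts as the map v |-> lam^k v + u, and the product as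
    composition.  Keeping the exponent k instead of the scalar lam^k makes every
    pair a group element.  The proof that lam <> 0 is a parameter of the type so
    that the group law can be inferred from it. *)
Definition affine of lam != 0 : Type := (int * F)%type.
Local Notation aff := (affine lam_neq0).
HB.instance Definition _ := Choice.on aff.

Definition affine_mul (g h : aff) : aff := (g.1 + h.1, g.2 + lam ^ g.1 * h.2).
Definition affine_inv (g : aff) : aff := (- g.1, - (lam ^ (- g.1) * g.2)).

Lemma affine_mulA : associative affine_mul.
Proof.
move=> [k u] [l v] [j w]; rewrite /affine_mul /= addrA expfzDr //.
by rewrite mulrDr addrA mulrA.
Qed.

Lemma affine_mul1 : left_id ((0, 0) : aff) affine_mul.
Proof. by move=> [k u]; rewrite /affine_mul /= expr0z mul1r !add0r. Qed.

Lemma affine_mulg1 : right_id ((0, 0) : aff) affine_mul.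
Proof. by move=> [k u]; rewrite /affine_mul /= mulr0 !addr0. Qed.

Lemma affine_mulVg : left_inverse ((0, 0) : aff) affine_inv affine_mul.
Proof. by move=> [k u]; rewrite /affine_mul /= !addNr. Qed.

Lemma affine_mulgV : right_inverse ((0, 0) : aff) affine_inv affine_mul.
Proof.
move=> [k u]; rewrite /affine_mul /= mulrN mulrA -expfzDr // subrr expr0z.
by rewrite mul1r !subrr.
Qed.

HB.instance Definition _ := isGroup.Build aff
  affine_mulA affine_mul1 affine_mulg1 affine_mulVg affine_mulgV.

Lemma affine_mulE (g h : aff) :
  (g * h)%g = (g.1 + h.1, g.2 + lam ^ g.1 * h.2) :> aff.
Proof. by []. Qed.

Lemma affine_invE (g : aff) :
  (g^-1)%g = (- g.1, - (lam ^ (- g.1) * g.2)) :> aff.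
Proof. by []. Qed.

Lemma affine_translationX (u : F) k : (((0, u) : aff) ^+ k)%g = (0, k%:R * u) :> aff.
Proof.
elim: k => [|k IH]; first by rewrite expg0 mul0r.
by rewrite expgS IH affine_mulE /= expr0z add0r mul1r mulrS mulrDl mul1r.
Qed.

Lemma affine_translationz (u : F) k : expgz ((0, u) : aff) k = (0, k%:~R * u).
Proof.
rewrite /expgz affine_translationX.
case: ifP => [k0|/negbT]; first by rewrite -{2}(gez0_abs k0).
rewrite -ltNge => k0; rewrite affine_invE /= oppr0 expr0z mul1r -mulNr.
by rewrite -{2}(opprK k) -(ltz0_abs k0) mulrNz.
Qed.

Definition affine_x : aff := (0, 1).
Definition affine_y : aff := (1, 0).

Lemma affine_yX k : (affine_y ^+ k)%g = (k%:Z, 0) :> aff.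
Proof.
elim: k => [|k IH]; first by [].
by rewrite expgS IH affine_mulE /= mulr0 add0r.
Qed.

(** The translation part of (xy)^k is the geometric sum 1 + lam + .. +
    lam^(k-1); multiplying by lam - 1 telescopes it. *)
Lemma affine_xyX k : ((affine_x * affine_y) ^+ k)%g.2 * (lam - 1) = lam ^+ k - 1.
Proof.
have -> : (affine_x * affine_y)%g = (1, 1) :> aff.
  by rewrite affine_mulE /= expr0z mulr0 addr0 add0r.
elim: k => [|k IH]; first by rewrite expg0 mul0r expr0 subrr.
rewrite expgS affine_mulE /= mulrDl mul1r -mulrA IH exprS expr1z; ring.
Qed.

Lemma affine_BS_rel (m n : int) : lam * m%:~R = n%:~R ->
  (affine_y * expgz affine_x m * affine_y^-1 = expgz affine_x n)%g.
Proof.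
move=> hmn; rewrite !affine_translationz 2!affine_mulE affine_invE /= !mulr1.
by rewrite addr0 subrr mulr0 oppr0 mulr0 addr0 add0r expr1z hmn.
Qed.

(** If z has linear part lam^l and translation part u, then [z, y^k] is the
    translation by lam^(-l) (lam^(-k) - 1) u. *)
Lemma affine_commutator_neq0 (z : aff) k : lam ^+ k != 1 ->
  z.2 != 0 -> ([~ z, affine_y ^+ k]%g : aff).2 != 0.
Proof.
move=> hk; case: z => l u /= u0.
rewrite affine_yX /commg /conjg /=.
rewrite !mulr0 oppr0 addr0 add0r addrC.
have -> : lam ^ (- l) * (lam ^ (- k%:Z) * u) - lam ^ (- l) * u =
          lam ^ (- l) * ((lam ^ (- k%:Z) - 1) * u) by ring.
rewrite !mulf_neq0 ?expfz_neq0 // subr_eq0 -exprz_inv -exprnP exprVn.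
by rewrite invr_eq1.
Qed.

End AffineGroup.

Lemma affine_action_BS (F : fieldType) (lam : F) (lam0 : lam != 0%R) (m n : int) :
  (lam * m%:~R = n%:~R)%R ->
  exists2 psi : {multiplicative BS m n -> affine lam0},
    psi (BSx m n) = affine_x lam0 & psi (BSy m n) = affine_y lam0.
Proof. by move=> /(@affine_BS_rel _ _ lam0)/BS_lift. Qed.

(** * Faithfulness on x, and failure of virtual nilpotency *)

Section NotVirtuallyNilpotent.
Local Open Scope group_scope.

Lemma BSx_infinite_order (m n : int) (k : nat) :
  m != 0%R -> n != 0%R -> (0 < k)%N -> BSx m n ^+ k <> 1.
Proof.
move=> m0 n0 k0 xk.
pose lam : rat := (n%:~R / m%:~R)%R.
have lam0 : lam != 0%R by rewrite mulf_neq0 ?invr_eq0 ?intr_eq0.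
have [|psi psix _] := @affine_action_BS _ _ lam0 m n.
  by rewrite mulfVK // intr_eq0.
have /(congr1 snd) : psi (BSx m n ^+ k) = psi 1 by rewrite xk.
rewrite multiplicative_gmulfX multiplicative_gmulf1 psix affine_translationX /=.
by rewrite mulr1 => /eqP; rewrite pnatr_eq0 -leqn0 leqNgt k0.
Qed.

(** The translation part of xy stays nonzero when passing to the k-th power and
    under repeated commutation with y^k. *)
Lemma BS_not_engel (F : fieldType) (lam : F) (m n : int) (k i : nat) :
  (forall j, (0 < j)%N -> lam ^+ j != 1)%R -> lam != 0%R ->
  (lam * m%:~R = n%:~R)%R -> (0 < k)%N ->
  iter i (fun z => [~ z, BSy m n ^+ k]) ((BSx m n * BSy m n) ^+ k) <> 1.
Proof.
move=> hlam lam0 hmn k0 engel.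
have [psi psix psiy] := affine_action_BS lam0 hmn.
suff: (psi (iter i (fun z => [~ z, BSy m n ^+ k])
        ((BSx m n * BSy m n) ^+ k))).2 != 0%R.
  by rewrite engel multiplicative_gmulf1 eqxx.
elim: i {engel} => [|i IH] /=.
  rewrite multiplicative_gmulfX gmulfM psix psiy.
  apply: contraTneq (hlam k k0) => xy0.
  by rewrite negbK -subr_eq0 -(affine_xyX lam0) xy0 mul0r.
rewrite multiplicative_gmulfR multiplicative_gmulfX psiy.
by apply: affine_commutator_neq0 => //; exact: hlam.
Qed.

Lemma intr_pchar0 (R : nzRingType) (p : nat) (k : int) :
  (p%:R = 0 :> R)%R -> (p %| `|k|)%N -> (k%:~R = 0 :> R)%R.
Proof.
move=> p0 /dvdnP[q kq]; rewrite (intEsign k) kq PoszM !intrM.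
by rewrite -(pmulrn _ p) p0 !mulr0.
Qed.

Lemma tofracX_not_root1 (p j : nat) : (0 < j)%N ->
  (tofrac ('X : {poly 'F_p}) ^+ j != 1)%R.
Proof.
move=> j0; rewrite -tofracXn -tofrac1 tofrac_eq.
apply: contraTneq j0 => /(congr1 (size \o @polyseq _)) /=.
by rewrite size_polyXn size_poly1 => -[->].
Qed.

Lemma tofrac_pchar0 (p : nat) : prime p ->
  (p%:R = 0 :> {fraction {poly 'F_p}})%R.
Proof.
move=> p_pr; rewrite -(rmorph_nat (@tofrac {poly 'F_p})) -polyC_natr.
by rewrite (pchar_Fp_0 p_pr) polyC0 rmorph0.
Qed.

Lemma rat_quotient_not_root1 (m n : int) (j : nat) :
  m != 0%R -> `|m|%N != `|n|%N -> (0 < j)%N ->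
  ((n%:~R / m%:~R : rat) ^+ j != 1)%R.
Proof.
move=> m0 ne_mn j0; apply: contra_neq ne_mn => lamj.
have /eqP : (`|n%:~R / m%:~R : rat| ^+ j = 1)%R by rewrite -normrX lamj normr1.
rewrite pexpr_eq1 // normf_div -!intr_norm.
by move=> /eqP/divr1_eq/intr_inj; lia.
Qed.

(** When |m| = |n| a field of characteristic zero only offers lam = 1 or -1;
    in characteristic p dividing m the equation no longer constrains lam, so an
    indeterminate can be taken. *)
Lemma BS_multiplier (m n : int) : m != 0%R -> n != 0%R ->
  ~ (`|m|%R = 1%R /\ `|n|%R = 1%R) ->
  exists (F : fieldType) (lam : F),
    [/\ forall j, (0 < j)%N -> (lam ^+ j != 1)%R, lam != 0%R
      & (lam * m%:~R = n%:~R)%R].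
Proof.
move=> m0 n0 hmn; have [eq_mn|ne_mn] := eqVneq `|m|%N `|n|%N; last first.
  exists rat, (n%:~R / m%:~R)%R; split; last by rewrite mulfVK // intr_eq0.
    by move=> j; exact: rat_quotient_not_root1.
  by rewrite mulf_neq0 ?invr_eq0 ?intr_eq0.
have m1 : (1 < `|m|)%N by move: hmn eq_mn m0; lia.
have p_pr : prime (pdiv `|m|%N) by exact: pdiv_prime.
have p0 := tofrac_pchar0 p_pr.
have pm : (pdiv `|m| %| `|m|)%N by exact: pdiv_dvd.
exists {fraction {poly 'F_(pdiv `|m|%N)}}, (tofrac 'X); split.
- by move=> j; exact: tofracX_not_root1.
- by rewrite tofrac_eq0 polyX_eq0.
- by rewrite (intr_pchar0 p0 pm) (intr_pchar0 (k := n) p0) ?mulr0 // -eq_mn.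
Qed.

End NotVirtuallyNilpotent.

Lemma BS_not_virtually_nilpotent_image (m n : int) (G : groupType)
    (phi : {multiplicative BS m n -> G}) :
  m != 0%R -> n != 0%R -> ~ (`|m|%R = 1%R /\ `|n|%R = 1%R) ->
  injective phi -> ~ virtually_nilpotent (range phi).
Proof.
move=> m0 n0 hmn phiI vnil.
have [F [lam [hlam lam0 lammn]]] := BS_multiplier m0 n0 hmn.
have [||k [i [k0 engel]]] := virtually_nilpotent_engel
  (g := phi (BSx m n * BSy m n)%g) (h := phi (BSy m n))
  (gmulf_range_subgroup phi) vnil; [by eexists | by eexists |].
apply: (@BS_not_engel _ _ _ _ k i hlam lam0 lammn k0).
apply: phiI; rewrite multiplicative_gmulf1 -engel {engel}.
elim: i => [|i IH] /=; first by rewrite multiplicative_gmulfX.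
by rewrite multiplicative_gmulfR multiplicative_gmulfX IH.
Qed.

(** * Triple products of a progression together with b *)

Section Counting.
Local Open Scope group_scope.
Variables (G : groupType) (a b : G).

Definition mulseq (U V : seq G) : seq G := [seq u * v | u <- U, v <- V].

Lemma mem_mulseq U V u v : u \in U -> v \in V -> u * v \in mulseq U V.
Proof. exact: allpairs_f. Qed.

(** The powers of a with exponent between - K and K, shifted so as to be indexed
    by natural numbers. *)
Definition window K : seq G := [seq a ^- K * a ^+ s | s <- iota 0 (2 * K).+1].

Lemma mem_window K i j : (i <= K)%N -> (j <= K)%N ->
  a ^+ i * a ^- j \in window K.
Proof.
move=> iK jK; apply/mapP; exists (K + i - j)%N; first by rewrite mem_iota; lia.
by rewrite expgnFr; [rewrite expgnDr -!mulgA mulKg | lia].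
Qed.

Lemma window_power K i : (i <= K)%N -> a ^+ i \in window K.
Proof. by move=> iK; have := mem_window iK (leq0n K); rewrite expg0 invg1 mulg1. Qed.

Definition progression k : {fset G} :=
  [fset g in b :: [seq a ^+ i | i <- iota 0 k]]%fset.

Lemma progressionP k g : g \in progression k ->
  g = b \/ exists2 i, (i < k)%N & g = a ^+ i.
Proof.
rewrite !inE => /orP[/eqP ->|/mapP[i]]; first by left.
by rewrite mem_iota => ik ->; right; exists i.
Qed.

Lemma card_progression k : infinite_order a -> (k <= #|` progression k|)%N.
Proof.
move=> a_inf; rewrite -{1}(size_iota 0 k) -(size_map (fun i => a ^+ i)).
apply: uniq_leq_size => [|g]; last by rewrite !inE => ->; rewrite orbT.
rewrite map_inj_uniq ?iota_uniq // => i j.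
wlog lt_ij : i j / (i < j)%N => [wl|/eqP].
  by case: (ltngtP i j) => [lt|lt /esym|//] /wl; [|move/(_ lt)]; auto.
rewrite -(subnKC (ltnW lt_ij)) expgnDr -{1}(mulg1 (a ^+ i)).
by move=> /eqP/mulgI/esym/a_inf; case; rewrite subn_gt0.
Qed.

Variables (M N : nat).
Hypotheses (M_gt0 : (0 < M)%N)
  (rel : b * a ^+ M = a ^+ N * b \/ b * a ^+ M = a ^- N * b).

(** Writing j = q M + r, the part a^(q M) crosses b to the left and becomes
    a power of a with exponent N q or - N q, to be merged with a^i. *)
Lemma collect_power K i j : (i + N * j <= K)%N ->
  exists s r, [/\ s \in window K, (r < M)%N &
    a ^+ i * b * a ^+ j = s * b * a ^+ r].
Proof.
move=> ijK; pose q := (j %/ M)%N.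
have qj : (N * q <= N * j)%N by rewrite leq_mul2l leq_div orbT.
have slide c p : b * a ^+ M = c * b -> b * a ^+ (p * M) = c ^+ p * b.
  move=> hc; elim: p => [|p IH]; first by rewrite mul0n !expg0 mulg1 mul1g.
  by rewrite mulSn expgnDr mulgA hc -mulgA IH mulgA -expgS.
have rM : (j %% M < M)%N by rewrite ltn_mod.
rewrite {1}(divn_eq j M) expgnDr -/q -mulgA [b * _]mulgA.
case: rel => /(@slide _ q) ->; rewrite ?expVgn -expgnA.
  exists (a ^+ (i + N * q)), (j %% M)%N; split=> //.
    by apply: window_power; lia.
  by rewrite expgnDr !mulgA.
exists (a ^+ i * a ^- (N * q)), (j %% M)%N; split=> //.
  by apply: mem_window; lia.
by rewrite !mulgA.
Qed.

(** The normal forms b^e s (b^d a^r b^f) with e, d, f in {0, 1}, s in the window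
    and r < M. *)
Definition cover K : seq G :=
  mulseq (mulseq [:: 1; b] (window K))
    (mulseq (mulseq [:: 1; b] [seq a ^+ r | r <- iota 0 M]) [:: 1; b]).

Lemma size_cover K : size (cover K) = (8 * M * (2 * K).+1)%N.
Proof. by rewrite /cover /mulseq !size_allpairs !size_map !size_iota /=; lia. Qed.

Lemma mem_cover K (e d f : bool) s r g : s \in window K -> (r < M)%N ->
  g = b ^+ e * s * (b ^+ d * a ^+ r * b ^+ f) -> g \in cover K.
Proof.
have mem1b (c : bool) : b ^+ c \in [:: 1; b].
  by case: c; rewrite ?expg0 ?expg1 !inE eqxx ?orbT.
move=> sK rM ->; rewrite !mem_mulseq //.
by apply: map_f; rewrite mem_iota.
Qed.

(** The window must contain the exponents i + j + l of a product of three powers,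
    which are below 3 k, and the shifted exponents i + N (j + l) coming from the
    products that involve b, which are below (2 N + 1) k. *)
Lemma triple_product_cover k :
  {subset triple_product (progression k) <= cover ((2 * N + 3) * k)}.
Proof.
set K := ((2 * N + 3) * k)%N => g /imfsetP[[[g1 g2] g3]] /=.
rewrite !inE /= -!andbA => /and3P[h1 h2 h3] ->.
have {}h1 : g1 \in progression k by rewrite !inE.
have {}h2 : g2 \in progression k by rewrite !inE.
have {}h3 : g3 \in progression k by rewrite !inE.
have W1 : 1 \in window K by rewrite -(expg0 a) window_power.
have collect i j l : (i < k)%N -> (j < k)%N -> (l < k)%N ->
    exists s r, [/\ s \in window K, (r < M)%N &
      a ^+ i * b * a ^+ (j + l) = s * b * a ^+ r].
  by move=> ik jk lk; apply: collect_power; rewrite /K; nia.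
case: (progressionP h1) => [->|[i ik ->]];
case: (progressionP h2) => [->|[j jk ->]];
case: (progressionP h3) => [->|[l lk ->]].
(* The eight cases are b b b, b b a, b a b, b a a, a b b, a b a, a a b, a a a. *)
- apply: (mem_cover (e := true) (d := true) (f := true) W1 M_gt0).
  by rewrite expg0 !expg1 !mulg1 !mulgA.
- have [s [r [sW rM]]] := collect 0 0 l (leq_ltn_trans (leq0n l) lk)
    (leq_ltn_trans (leq0n l) lk) lk.
  rewrite add0n expg0 mul1g => E.
  apply: (mem_cover (e := true) (d := true) (f := false) sW rM).
  by rewrite expg0 !expg1 mulg1 -mulgA E !mulgA.
- have [s [r [sW rM]]] := collect 0 0 j (leq_ltn_trans (leq0n j) jk)
    (leq_ltn_trans (leq0n j) jk) jk.
  rewrite add0n expg0 mul1g => E.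
  apply: (mem_cover (e := false) (d := true) (f := true) sW rM).
  by rewrite expg0 !expg1 mul1g E !mulgA.
- have [s [r [sW rM]]] := collect 0 j l (leq_ltn_trans (leq0n j) jk) jk lk.
  rewrite expg0 mul1g expgnDr mulgA => E.
  apply: (mem_cover (e := false) (d := true) (f := false) sW rM).
  by rewrite expg0 !expg1 mul1g mulg1 E !mulgA.
- have iW : a ^+ i \in window K by apply: window_power; rewrite /K; nia.
  apply: (mem_cover (e := false) (d := true) (f := true) iW M_gt0).
  by rewrite !expg0 !expg1 mul1g mulg1 !mulgA.
- have [s [r [sW rM]]] := collect i 0 l ik (leq_ltn_trans (leq0n l) lk) lk.
  rewrite add0n => E.
  apply: (mem_cover (e := false) (d := true) (f := false) sW rM).
  by rewrite expg0 !expg1 mul1g mulg1 E !mulgA.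
- have iW : a ^+ (i + j) \in window K by apply: window_power; rewrite /K; nia.
  apply: (mem_cover (e := false) (d := true) (f := false) iW M_gt0).
  by rewrite !expg0 !expg1 mul1g !mulg1 expgnDr.
- have iW : a ^+ (i + j + l) \in window K by apply: window_power; rewrite /K; nia.
  apply: (mem_cover (e := false) (d := false) (f := false) iW M_gt0).
  by rewrite !expg0 mul1g !mulg1 !expgnDr.
Qed.

Lemma card_triple_product k :
  (0 < k)%N -> (#|` triple_product (progression k)| <= 8 * M * (4 * N + 7) * k)%N.
Proof.
move=> k0; apply: (@leq_trans (size (cover ((2 * N + 3) * k)))).
  by apply: uniq_leq_size; [exact: fset_uniq | exact: triple_product_cover].
by rewrite size_cover -!mulnA !leq_mul2l /=; nia.
Qed.

End Counting.

(** * Failure of growth *)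

Lemma gen_subgroup_progression (m n : int) (G : groupType)
    (phi : {multiplicative BS m n -> G}) k : (1 < k)%N ->
  gen_subgroup [set` progression (phi (BSx m n)) (phi (BSy m n)) k]%classic =
  range phi.
Proof.
move=> k1; apply/seteqP; split.
  apply: gen_subgroup_sub; first exact: gmulf_range_subgroup.
  move=> g /= /progressionP[->|[i _ ->]]; first by eexists.
  by exists (BSx m n ^+ i)%g => //; rewrite multiplicative_gmulfX.
apply: range_presented_sub; first exact: gen_subgroup_is_subgroup.
case; apply: sub_gen_subgroup => /=; last by rewrite !inE eqxx.
rewrite !inE; apply/orP; right; apply/mapP; exists 1%N; rewrite ?expg1 //.
by rewrite mem_iota.
Qed.

(** For m < 0 the relation is inverted, so that the exponent of a on the left of
    the equation is always |m|; the sign then moves to the right-hand side. *)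
Lemma expgz_nat_rel (G : groupType) (a b : G) (m n : int) :
  (b * expgz a m * b^-1 = expgz a n)%g ->
  (b * a ^+ `|m| = a ^+ `|n| * b \/ b * a ^+ `|m| = a ^- `|n| * b)%g.
Proof.
have shift u v : (b * u * b^-1 = v -> b * u = v * b)%g by move=> <-; rewrite mulgVK.
rewrite /expgz; case: ifP => _.
  by case: ifP => _ /shift; [left | right].
move=> /(congr1 (fun g : G => g^-1)%g); rewrite !invgM !invgK mulgA.
by case: ifP => _; rewrite ?invgK => /shift; [right | left].
Qed.

(** Since k^(1 + delta) = k k^delta, it suffices that k^delta exceed |C| / c,
    that is, k > (|C| / c)^(1 / delta). *)
Lemma powR_not_linearly_bounded (R : realType) (c delta C : R) (K : nat) :
  (0 < c)%R -> (0 < delta)%R ->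
  exists2 k, (K < k)%N & (C * k%:R < c * k%:R `^ (1 + delta))%R.
Proof.
move=> c0 d0; pose B := (`|C| / c)%R.
have B0 : (0 <= B)%R by rewrite divr_ge0 // ltW.
set T := Num.truncn (B `^ delta^-1).
pose k := maxn K.+1 T.+1.
have Kk : (K < k)%N by exact: leq_maxl.
have k0 : (0 < k%:R :> R)%R by rewrite ltr0n (leq_ltn_trans _ Kk).
exists k => //.
have lt_k : (B `^ delta^-1 < k%:R)%R.
  apply: lt_le_trans (truncnS_gt _) _.
  by rewrite ler_nat leq_maxr.
have : (B < k%:R `^ delta)%R.
  have -> : B = ((B `^ delta^-1) `^ delta)%R.
    by rewrite -powRrM mulVf ?powRr1 // gt_eqF.
  by rewrite gt0_ltr_powR // nnegrE ?powR_ge0 // ltW.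
rewrite ltr_pdivrMr // mulrC => lt_C.
rewrite powRD; last by rewrite (gt_eqF k0) implybT.
rewrite powRr1; last exact: ltW.
rewrite mulrCA [ltRHS]mulrC ltr_pM2r //.
exact: le_lt_trans (ler_norm _) lt_C.
Qed.

Lemma BS_image_no_growth (R : realType) (m n : int) (G : groupType)
    (phi : {multiplicative BS m n -> G}) :
  m != 0%R -> infinite_order (phi (BSx m n)) ->
  ~ virtually_nilpotent (range phi) -> ~ helfgott_type_growth R G.
Proof.
move=> m0 x_inf nvn [c [delta [c0 d0 growth]]].
have M0 : (0 < `|m|)%N by rewrite absz_gt0.
pose C := (8 * `|m| * (4 * `|n| + 7))%N.
have [k k1 lt_k] := powR_not_linearly_bounded C%:R 1 c0 d0.
pose A := progression (phi (BSx m n)) (phi (BSy m n)) k.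
have A_large : (k <= #|` A|)%N by exact: card_progression.
have A0 : A != fset0 by rewrite -cardfs_gt0; lia.
have := growth A A0; rewrite gen_subgroup_progression // => /(_ nvn).
apply/negP; rewrite -ltNge; apply: le_lt_trans (lt_le_trans lt_k _).
  rewrite -natrM ler_nat; apply: card_triple_product M0 _ _ _; last lia.
  exact: expgz_nat_rel (BS_morph_rel phi).
rewrite ler_pM2l // ge0_ler_powR ?nnegrE ?ler_nat //; lra.
Qed.

Theorem theorem4p3 (R : realType) (m n : int)
  (hm : m != 0%R) (hn : n != 0%R)
  (hmn : ~ (`|m|%R = 1%R /\ `|n|%R = 1%R))
  (G : groupType)
  (hG : (exists H : set G, isomorphic_subgroup (BS m n) H) \/
        (exists phi : {multiplicative BS m n -> G},
           infinite_order (phi (BSx m n)) /\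
           ~ virtually_nilpotent (range phi))) :
  ~ helfgott_type_growth R G.
Proof.
case: hG => [[H [_ [phi [_ /in2TT phiI _]]]]|[phi [x_inf nvn]]]; last first.
  exact: BS_image_no_growth hm x_inf nvn.
apply: (@BS_image_no_growth _ _ _ _ phi hm).
  move=> k k0; rewrite -multiplicative_gmulfX -(multiplicative_gmulf1 phi).
  by move/phiI; exact: BSx_infinite_order.
exact: BS_not_virtually_nilpotent_image.
Qed.
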